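(* In the setting of the context (the convex problem $\min_{u\in V}E(u)$, $E=F+G$, and the additive Schwarz method with backtracking), suppose that the stable decomposition, strengthened convexity, local stability and sharpness assumptions hold (with constants $q>1$, $C_{0,K}$, $\tau_0$, $\omega_0$, $p>1$, $\mu_K$), and write $\mu=\mu_{K_0}$. Let $\{u^{(n)}\}$, $\{\tau^{(n)}\}$ be generated by the additive Schwarz method with backtracking. Let $\nu=-\frac1{q-1}$ and, for $n\ge1$, $$\bar\kappa_\nu=\left(\frac1n\sum_{j=1}^n\kappa_{\tau^{(j)},\omega}^{\nu}\right)^{1/\nu},\qquad \kappa_{\tau,\omega}=\frac{\omega\,C_{0,K_\tau}^q}{\tau^{q-1}}.$$ 1. In the case $p=q$, we have $$\frac{E(u^{(n+1)})-E(u^* )}{E(u^{(n)})-E(u^* )}\le 1-\tau^{(n+1)}\min\left\{1-\frac{\omega C_{0,K_{\tau^{(n+1)}}}^q}{\mu},\ \frac{q-1}{q}\left(\frac{\mu}{q\,\omega\, C_{0,K_{\tau^{(n+1)}}}^q}\right)^{\frac1{q-1}}\right\}$$ for $n\ge0$. In particular, if $\mu\le q\,\omega\, C_{0,K_0}^q$, then $$E(u^{(n)})-E(u^* )\le\left(1-\frac{q-1}{q}\left(\frac{\mu}{q\bar\kappa_\nu}\right)^{-\nu}\right)^n\left(E(u^{(0)})-E(u^* )\right)$$ for $n\ge1$. 2. In the case $p>q$, if $\zeta_0:=E(u^{(0)})-E(u^* )\le\left(p^{\frac qp}\omega C_{0,K_0}^q/\mu^{\frac qp}\right)^{\frac p{p-q}}$,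 then $$E(u^{(n)})-E(u^* )\le\frac{\left(\dfrac{pq}{p-q}\right)^{\frac{p(q-1)}{p-q}}\left(\dfrac{p^{\frac qp}\bar\kappa_\nu}{\mu^{\frac qp}}\right)^{\frac p{p-q}}}{\left(n+\dfrac{pq}{p-q}\left(\dfrac{p^{\frac qp}\bar\kappa_\nu}{\mu^{\frac qp}}\right)^{-\nu}\Big/\zeta_0^{\frac{p-q}{p(q-1)}}\right)^{\frac{p(q-1)}{p-q}}}$$ for $n\ge1$.
   Context: **Problem.** $V$ is a reflexive Banach space with norm $\|\cdot\|$, $F:V\to\mathbb R$ is convex and Fréchet differentiable, $G:V\to\overline{\mathbb R}$ (extended reals) is proper, convex and lower semicontinuous, $E=F+G$ is coercive, and $u^*\in V$ is a minimizer of $E$. $\operatorname{dom}G=\{v\in V: G(v)<\infty\}$. The Bregman distance is $D_F(u,v)=F(u)-F(v)-\langle F'(v),u-v\rangle$. **Space decomposition.** For $1\le k\le N$, $V_k$ is a reflexive Banach space and $R_k^*:V_k\to V$ is a bounded linear operator whose adjoint $R_k:V^*\to V_k^*$ is surjective, with $V=\sum_{k=1}^N R_k^*V_k$. The functionals $d_k,G_k:V_k\times V\to\overline{\mathbb R}$ are proper, convex and lower semicontinuous with respect to their first arguments. **Assumption (stable decomposition).** There is a constant $q>1$ such that for every bounded convex $K\subseteq V$ the following holds: for any $u,v\in K\cap\operatorname{dom}G$ there exist $w_k\in V_k$, $1\le k\le N$, with $u-v=\sum_k R_k^*w_k$, such that $$\sum_{k=1}^N d_k(w_k,v)\le\frac{C_{0,K}^q}{q}\|u-v\|^q,\qquad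 \sum_{k=1}^N G_k(w_k,v)\le G(u)+(N-1)G(v),$$ where $C_{0,K}$ is a positive constant depending on $K$. The constants are understood to be monotone: $C_{0,K}\le C_{0,K'}$ if $K\subseteq K'$. **Assumption (strengthened convexity).** There is $\tau_0\in(0,1]$ such that for any $v\in V$, $w_k\in V_k$ ($1\le k\le N$) and $\tau\in(0,\tau_0]$, $$(1-\tau N)E(v)+\tau\sum_{k=1}^N E(v+R_k^*w_k)\ge E\Big(v+\tau\sum_{k=1}^N R_k^*w_k\Big).$$ **Assumption (local stability).** There is $\omega_0>0$ such that for any $v\in\operatorname{dom}G$ and $w_k\in V_k$, $1\le k\le N$: $D_F(v+R_k^*w_k,v)\le\omega_0 d_k(w_k,v)$ and $G(v+R_k^*w_k)\le G_k(w_k,v)$. **Assumption (sharpness).** There is $p>1$ such that for every bounded convex $K\subseteq V$ with $u^*\in K$ we have $\frac{\mu_K}{p}\|u-u^*\|^p\le E(u)-E(u^* )$ for all $u\in K$, for some $\mu_K>0$. **Additive Schwarz method with backtracking.** Choose $u^{(0)}\in\operatorname{dom}G$, $\tau^{(0)}=\tau_0$, $\omega\ge\omega_0$, $\rho\in(0,1)$. For $n=0,1,2,\dots$: take, for $1\le k\le N$, $$w_k^{(n+1)}\in\arg\min_{w_k\in V_k}\{F(u^{(n)})+\langle F'(u^{(n)}),R_k^*w_k\rangle+\omega d_k(w_k,u^{(n)})+G_k(w_k,u^{(n)})\}.$$ Start with $\tau=\tau^{(n)}/\rho$; as long as the criterion $$E\Big(u^{(n)}+\tau\sum_{k=1}^N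 R_k^*w_k^{(n+1)}\Big)\le(1-\tau N)E(u^{(n)})+\tau\sum_{k=1}^N E(u^{(n)}+R_k^*w_k^{(n+1)})$$ fails, replace $\tau$ by $\rho\tau$. When it holds, set $\tau^{(n+1)}=\tau$ and $u^{(n+1)}=u^{(n)}+\tau^{(n+1)}\sum_{k=1}^N R_k^*w_k^{(n+1)}$. **Notation.** $K_0=\{u\in V:E(u)\le E(u^{(0)})\}$, which is bounded and convex; for $\tau>0$, $K_\tau=\{\frac1\tau u-(\frac1\tau-1)v:u,v\in K_0\}$.
   Formalization: The linear rate in part 1 (''in particular'') is stated for n with E(u^(n-1)) ≠ E(u* ): once a minimizer is reached, backtracking can enlarge τ without limit, so the base of the n-th power can become negative and the printed bound fails for odd n. *)

(* Defs.v *)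
From HB Require Import structures.
From mathcomp Require Import all_boot all_order all_algebra.
From mathcomp Require Import all_classical all_reals all_analysis.

Set Implicit Arguments.
Unset Strict Implicit.
Unset Printing Implicit Defensive.

Import Order.TTheory GRing.Theory Num.Theory.
Import numFieldNormedType.Exports.

Local Open Scope classical_set_scope.
Local Open Scope ring_scope.
Local Open Scope ereal_scope.

Section Functionals.
Context {R : realType} {V : normedModType R}.
Implicit Types (f : V -> \bar R).

Definition proper_functional f : Prop :=
  (forall x, -oo < f x) /\ (exists x, f x < +oo).

(* For a functional that never takes the value -oo no indeterminate sum occurs
   on the right-hand side; at t = 0 or t = 1, 0 * +oo = 0. *)
Definition convex_functional f : Prop :=
  forall (x y : V) (t : R), (0 <= t <= 1)%R ->
    f (t *: x + (1 - t) *: y)%R <= t%:E * f x + (1 - t)%:E * f y.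

Definition pcl_functional f : Prop :=
  [/\ proper_functional f, convex_functional f & lower_semicontinuous f].

Definition coercive f : Prop :=
  forall M : R, exists r : R, forall v : V, (r < `|v|)%R -> M%:E < f v.

Definition edom f : set V := [set v | f v < +oo].

End Functionals.

Definition is_argmin {R : realType} {T : Type} (f : T -> \bar R) (x : T) : Prop :=
  forall y, f x <= f y.

Section Duality.
Context {R : realType}.

Definition topological_dual (V : normedModType R) : set (V -> R^o) :=
  [set f | linear f /\ continuous f].

Arguments topological_dual V : clear implicits.

Definition dual_norm (V : normedModType R) (f : V -> R^o) : R :=
  sup [set `|f x|%R | x in [set x : V | (`|x| <= 1)%R]].

(* Elements of the bidual; only the values on [topological_dual V] matter. *)
Definition topological_bidual (V : normedModType R) : set ((V -> R^o) -> R) :=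
  [set Phi |
    (forall (a : R) (f g : V -> R^o),
       topological_dual V f -> topological_dual V g ->
       Phi (fun x => a * f x + g x) = a * Phi f + Phi g)%R /\
    (exists M : R, forall f, topological_dual V f ->
       (`|Phi f| <= M * dual_norm f)%R)].

Arguments topological_bidual V : clear implicits.

(* The canonical map from V to its bidual is onto. *)
Definition reflexive_space (V : normedModType R) : Prop :=
  forall Phi, topological_bidual V Phi ->
    exists v : V, forall f, topological_dual V f -> Phi f = f v.

Definition adjoint (U V : normedModType R) (T : U -> V)
  (f : V -> R^o) : U -> R^o := f \o T.

Definition adjoint_surjective (U V : normedModType R) (T : U -> V) : Prop :=
  set_surj (topological_dual V) (topological_dual U) (adjoint T).

Definition bounded_operator (U V : normedModType R) (T : U -> V) : Prop :=
  exists M : R, forall x, (`|T x| <= M * `|x|)%R.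

End Duality.

Section Problem.
Context {R : realType} {V : completeNormedModType R} {N : nat}.
Context {Vk : 'I_N -> completeNormedModType R}.
Variables (F : V -> R^o) (G : V -> \bar R).
(* [Rs k] is the operator R_k^* from V_k to V. *)
Variable Rs : forall k, {linear Vk k -> V}.
Variables (d Gk : forall k, Vk k -> V -> \bar R).

Definition energy (v : V) : \bar R := (F v)%:E + G v.

Definition bregman (u v : V) : R := (F u - F v - 'd F v (u - v))%R.

Definition space_decomposition : Prop :=
  forall v : V, exists w : forall k, Vk k, v = (\sum_(k < N) Rs k (w k))%R.

Definition bounded_convex (K : set V) : Prop := bounded_set K /\ convex_set K.

Definition stable_decomposition (q : R) (C0 : set V -> R) : Prop :=
  [/\ (1 < q)%R,
      (forall K, bounded_convex K -> (0 < C0 K)%R),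
      (forall K K', bounded_convex K -> bounded_convex K' ->
         K `<=` K' -> (C0 K <= C0 K')%R) &
      (forall K, bounded_convex K ->
         forall u v, (K `&` edom G) u -> (K `&` edom G) v ->
         exists w : forall k, Vk k,
           [/\ (u - v = \sum_(k < N) Rs k (w k))%R,
               \sum_(k < N) d (w k) v <=
                 (C0 K `^ q / q * `|u - v| `^ q)%:E &
               \sum_(k < N) Gk (w k) v <= G u + (N%:R - 1)%:E * G v])].

(* Only points v of finite energy are considered: for v outside of dom G the
   larger side is +oo when [tau * N < 1], and otherwise contains the product of
   +oo with a nonpositive number. *)
Definition strengthened_convexity (tau0 : R) : Prop :=
  (0 < tau0 <= 1)%R /\
  forall (v : V) (w : forall k, Vk k) (tau : R),
    edom G v -> (0 < tau <= tau0)%R ->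
    energy (v + tau *: \sum_(k < N) Rs k (w k))%R <=
    (1 - tau * N%:R)%:E * energy v
      + tau%:E * \sum_(k < N) energy (v + Rs k (w k))%R.

Definition local_stability (omega0 : R) : Prop :=
  (0 < omega0)%R /\
  forall (v : V) (w : forall k, Vk k) (k : 'I_N), edom G v ->
    (bregman (v + Rs k (w k)) v)%:E <= omega0%:E * d (w k) v /\
    G (v + Rs k (w k))%R <= Gk (w k) v.

Definition sharpness (ustar : V) (p : R) (mu : set V -> R) : Prop :=
  (1 < p)%R /\
  forall K, bounded_convex K -> K ustar ->
    (0 < mu K)%R /\
    forall u, K u ->
      (mu K / p * `|u - ustar| `^ p)%:E <= energy u - energy ustar.

Definition local_functional (omega : R) (u : V) (k : 'I_N) (w : Vk k) : \bar R :=
  (F u + 'd F u (Rs k w))%:E + omega%:E * d w u + Gk w u.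

Definition backtracking_criterion (u : V) (w : forall k, Vk k) (tau : R) : Prop :=
  energy (u + tau *: \sum_(k < N) Rs k (w k))%R <=
  (1 - tau * N%:R)%:E * energy u
    + tau%:E * \sum_(k < N) energy (u + Rs k (w k))%R.

(* [w n] stands for w^(n+1); m is the number of times the trial step size
   [tau n / rho] is multiplied by rho. *)
Definition asm_backtracking (tau0 omega rho : R)
    (u : nat -> V) (w : nat -> forall k, Vk k) (tau : nat -> R) : Prop :=
  [/\ edom G (u 0%N),
      tau 0%N = tau0 &
      forall n,
        [/\ (forall k, is_argmin (local_functional omega (u n) (k := k)) (w n k)),
            (exists m : nat,
               [/\ tau n.+1 = (rho ^+ m * (tau n / rho))%R,
                   backtracking_criterion (u n) (w n) (tau n.+1) &
                   forall i, (i < m)%N ->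
                     ~ backtracking_criterion (u n) (w n)
                         (rho ^+ i * (tau n / rho))%R]) &
            u n.+1 = (u n + tau n.+1 *: \sum_(k < N) Rs k (w n k))%R]].

Definition initial_sublevel (u0 : V) : set V :=
  [set v | energy v <= energy u0].

End Problem.

Section Constants.
Context {R : realType} {V : normedModType R}.

Definition extrapolated_set (K0 : set V) (tau : R) : set V :=
  [set (tau^-1 *: z.1 - (tau^-1 - 1) *: z.2)%R | z in K0 `*` K0].

Definition kappa (q omega : R) (C0 : set V -> R) (K0 : set V) (tau : R) : R :=
  (omega * C0 (extrapolated_set K0 tau) `^ q / tau `^ (q - 1))%R.

Definition kappa_bar (q omega : R) (C0 : set V -> R) (K0 : set V)
    (tau : nat -> R) (nu : R) (n : nat) : R :=
  ((n%:R^-1 * \sum_(1 <= j < n.+1) kappa q omega C0 K0 (tau j) `^ nu)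
     `^ nu^-1)%R.

End Constants.

(* Main.v *)
(* Write zeta_n = E(u_n) - E(u_star), a = omega C_K^q with K = K_tau, and
   tau = tau_{n+1}. Summing the local minimality of the w_k against the stable
   decomposition of x - u_n, and using local stability and the tangent
   inequality for F, the backtracking criterion yields, for x in K,
     E(u_{n+1}) <= E(u_n) + tau (E(x) - E(u_n) + a / q |x - u_n|^q).
   Take x = t u_star + (1 - t) u_n in K_0, a subset of K_tau. Convexity bounds
   E(x), and sharpness bounds |u_n - u_star|^q by (p zeta_n / mu)^(q/p).
   Optimizing over t in [0, 1] gives a scalar recursion for zeta_n: linear when
   p = q, and zeta_{n+1} <= zeta_n - c_n zeta_n^(1+b) with
   b = (p - q) / (p (q - 1)) when p > q. The former is iterated with the AM-GM
   inequality, the latter through zeta_{n+1}^(-b) >= zeta_n^(-b) + b c_n. *)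
Require Import Defs.
From HB Require Import structures.
From mathcomp Require Import all_boot all_order all_algebra.
From mathcomp Require Import all_classical all_reals all_analysis.
From mathcomp Require Import ring lra.

Set Implicit Arguments.
Unset Strict Implicit.
Unset Printing Implicit Defensive.

Import Order.TTheory GRing.Theory Num.Theory.
Import numFieldNormedType.Exports.

Local Open Scope classical_set_scope.
Local Open Scope ring_scope.

(** * Real powers and scalar recursions *)

(* t is the stationary point of t - t^q / c. *)
Lemma powR_stationary (R : realType) (q c : R) : 1 < q -> 0 < c ->
  let t := (c / q) `^ (q - 1)^-1 in t `^ q / c = t / q.
Proof.
move=> q1 c0 t.
have q10 : 0 < q - 1 by rewrite subr_gt0.
have q0 : 0 < q by rewrite (lt_trans ltr01).
have cq : 0 < c / q by rewrite divr_gt0.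
have t0 : 0 < t by exact: powR_gt0.
have tE : t `^ (q - 1) = c / q.
  by rewrite -powRrM mulVf ?gt_eqF// powRr1// ltW.
rewrite -mulr_powRB1 ?ltW// tE; field.
by rewrite !gt_eqF.
Qed.

(** AM-GM for the factors [1 - x i], nonnegative by hypothesis. It turns a product of step-dependent
    contraction factors into an n-th power that only sees the mean of [x]. *)
Lemma prod_onem_le_mean (R : realFieldType) (n : nat) (x : 'I_n -> R) :
  (0 < n)%N -> (forall i, x i <= 1) ->
  \prod_(i < n) (1 - x i) <= (1 - n%:R^-1 * \sum_(i < n) x i) ^+ n.
Proof.
move=> n0 x1.
have /leif_le := @leif_AGM R 'I_n xpredT (fun i => 1 - x i)
  (fun i _ => etrans (subr_ge0 _ _) (x1 i)).
move=> H; apply: (le_trans H); move: H => _.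
rewrite card_ord sumrB sumr_const card_ord mulrBl -mulr_natl mulr1 divff
  ?pnatr_eq0 -?lt0n//.
by rewrite mulrC.
Qed.

(** Discrete counterpart of z' <= - c z^(1+b), along which z^(-b) grows at rate at least b c. The
    core is the Bernoulli-type bound (1 - x)^b (1 + b x) <= 1 for the relative decrease x = c
    z^b. *)
Lemma powR_decrease (R : realType) (b c y z : R) : 0 < b -> 0 <= c ->
  0 < z -> 0 < y -> y <= z - c * z `^ (1 + b) ->
  z `^ (- b) + b * c <= y `^ (- b).
Proof.
move=> b0 c0 z0 y0 yz.
have zb : z `^ (1 + b) = z * z `^ b.
  by rewrite powRD ?(gt_eqF z0) ?implybT// powRr1 ?ltW.
set x := c * z `^ b.
have yzx : y <= z * (1 - x) by apply: (le_trans yz); rewrite zb /x; lra.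
have x0 : 0 <= x by rewrite mulr_ge0// powR_ge0.
have x1 : 0 < 1 - x by rewrite -(pmulr_rgt0 _ z0) (lt_le_trans y0).
have xb1 : 0 < 1 + b * x by rewrite ltr_pwDl// mulr_ge0// ltW.
have zb0 : 0 < z `^ b by exact: powR_gt0.
have yb0 : 0 < y `^ b by exact: powR_gt0.
(* Take logarithms and use [ln (1 + y) <= y] twice. *)
have bern : (1 - x) `^ b * (1 + b * x) <= 1.
  rewrite -ler_ln ?posrE ?mulr_gt0 ?powR_gt0// lnM ?posrE ?powR_gt0//.
  rewrite ln_powR ln1.
  have l1 : ln (1 - x) <= - x by rewrite le_ln1Dx// ltrN2; lra.
  have l2 : ln (1 + b * x) <= b * x by rewrite le_ln1Dx//; lra.
  have : b * ln (1 - x) <= b * (- x) by rewrite ler_pM2l.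
  lra.
have yb : y `^ b <= z `^ b * (1 - x) `^ b.
  rewrite -powRM ?(ltW z0) ?(ltW x1)// ge0_ler_powR ?nnegrE ?(ltW b0) ?(ltW
    y0)//.
  by rewrite mulr_ge0 ?(ltW z0) ?(ltW x1).
rewrite !powRN.
have -> : (z `^ b)^-1 + b * c = (1 + b * x) / z `^ b.
  by rewrite /x; field; rewrite gt_eqF.
rewrite ler_pdivrMr// ler_pdivlMl//.
apply: (@le_trans _ _ (z `^ b * (1 - x) `^ b * (1 + b * x))).
  by rewrite ler_pM2r.
by rewrite -mulrA -[leRHS]mulr1 ler_pM2l.
Qed.

Lemma powRVl (R : realType) (x r : R) : 0 <= x -> x^-1 `^ r = (x `^ r)^-1.
Proof. by move=> x0; rewrite -powR_inv1// powRAC powR_inv1// powR_ge0. Qed.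

(** Explains the exponent nu = -1/(q-1): the power nu of kappa is linear in the step size, and it is
    the quantity that each step contributes to the decay. *)
Lemma powR_kappa (R : realType) (q a tau : R) : 1 < q -> 0 < a -> 0 < tau ->
  (a / tau `^ (q - 1)) `^ (- (q - 1)^-1) = tau / a `^ (q - 1)^-1.
Proof.
move=> q1 a0 tau0; have q10 : q - 1 != 0 by rewrite gt_eqF// subr_gt0.
rewrite powRN powRM ?(ltW a0) ?invr_ge0 ?powR_ge0// powRVl ?powR_ge0//.
by rewrite -powRrM divff// powRr1 ?(ltW tau0)// invfM invrK mulrC.
Qed.

(** The condition [c <= q] is what puts the stationary point (c/q)^(1/(q-1)) inside [0, 1]. *)
Lemma optimal_step (R : realType) (q c tau y z : R) :
  1 < q -> 0 < c -> c <= q ->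
  (forall t, 0 <= t <= 1 -> y <= z - tau * z * (t - t `^ q / c)) ->
  y <= z - tau * z * ((q - 1) / q * (c / q) `^ (q - 1)^-1).
Proof.
move=> q1 c0 cq /(_ ((c / q) `^ (q - 1)^-1)).
have q0 : 0 < q by rewrite (lt_trans ltr01).
have q10 : 0 < q - 1 by rewrite subr_gt0.
rewrite (powR_stationary q1 c0) powR_ge0/= => yz.
set t := _ `^ _ in yz *.
have -> : (q - 1) / q * t = t - t / q by field; rewrite gt_eqF.
apply: yz; apply: (@le_trans _ _ (1 `^ (q - 1)^-1)); last by rewrite powR1.
rewrite ge0_ler_powR ?nnegrE ?invr_ge0//.
- exact: ltW.
- by rewrite divr_ge0 ?(ltW c0) ?(ltW q0).
- by rewrite ler_pdivrMr// mul1r.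
Qed.

Lemma powR_invK (R : realType) (nu S : R) : nu != 0 -> 0 <= S ->
  (S `^ nu^-1) `^ nu = S.
Proof. by move=> nu0 S0; rewrite -powRrM mulVf// powRr1. Qed.

(* The factors [1 - x i] are nonnegative because the [z i] are: nothing forces
   this a priori, since backtracking may produce step sizes larger than 1. *)
Lemma linear_decay (R : realFieldType) (n : nat) (z x : nat -> R) :
  (forall i, (i < n)%N -> 0 < z i) -> 0 <= z n ->
  (forall i, (i < n)%N -> z i.+1 <= (1 - x i) * z i) ->
  (forall i, (i < n)%N -> x i <= 1) /\ z n <= \prod_(i < n) (1 - x i) * z 0%N.
Proof.
move=> z0 zn zS.
have x1 i : (i < n)%N -> x i <= 1.
  move=> ni; rewrite -subr_ge0 -(pmulr_lge0 _ (z0 _ ni)).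
  (* The last value [z n] is only known to be nonnegative, so the index with [i.+1 = n] is treated
     apart. *)
  apply: le_trans (zS _ ni); move: ni; rewrite leq_eqVlt => /predU1P[->//|ni].
  exact/ltW/z0.
split=> //; have : (n <= n)%N by [].
elim: {-2}n => [|k IH] kn; first by rewrite big_ord0 mul1r.
apply: (le_trans (zS _ kn)); rewrite big_ord_recr/= (mulrC (\prod__ _)) -mulrA.
by rewrite ler_wpM2l ?subr_ge0 ?x1// IH// ltnW.
Qed.

Lemma sublinear_decay (R : realType) (b : R) (n : nat) (z c : nat -> R) :
  0 < b -> (forall i, 0 <= c i) -> (forall i, (i <= n)%N -> 0 < z i) ->
  (forall i, (i < n)%N -> z i.+1 <= z i - c i * z i `^ (1 + b)) ->
  z 0%N `^ (- b) + b * \sum_(i < n) c i <= z n `^ (- b).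
Proof.
move=> b0 c0 z0 zS; have : (n <= n)%N by [].
elim: {-2}n => [|k IH] kn; first by rewrite big_ord0 mulr0 addr0.
rewrite big_ord_recr/= mulrDr addrA.
apply: (le_trans (lerD (IH (ltnW kn)) (lexx _))).
by apply: powR_decrease => //; [exact/z0/ltnW|exact: z0|exact: zS].
Qed.

(** Solves the telescoped bound on y^(-b) for y. The exponent g is 1/b, and X stands for p^(q/p)
    kbar / mu^(q/p). *)
Lemma sublinear_rate (R : realType) (p q X y z n : R) :
  1 < q -> q < p -> 0 < X -> 0 < y -> 0 < z -> 0 <= n ->
  let b := (p - q) / (p * (q - 1)) in
  let g := p * (q - 1) / (p - q) in
  z `^ (- b) + b * (n * ((q - 1) / q * X `^ (- (q - 1)^-1))) <= y `^ (- b) ->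
  y <= (p * q / (p - q)) `^ g * X `^ (p / (p - q)) /
       (n + p * q / (p - q) * X `^ (- (- (q - 1)^-1)) / z `^ b) `^ g.
Proof.
move=> q1 qp X0 y0 z0 n0 b g.
have q0 : 0 < q by rewrite (lt_trans ltr01).
have q10 : 0 < q - 1 by rewrite subr_gt0.
have p0 : 0 < p by rewrite (lt_trans q0).
have pq0 : 0 < p - q by rewrite subr_gt0.
have b0 : 0 < b by rewrite divr_gt0// mulr_gt0.
have g0 : 0 < g by rewrite divr_gt0// mulr_gt0.
have bg : b * g = 1 by rewrite /b /g; field; rewrite !gt_eqF.
rewrite opprK !powRN; set W := X `^ (q - 1)^-1.
have W0 : 0 < W by exact: powR_gt0.
set D := p * q / (p - q).
have D0 : 0 < D by rewrite divr_gt0// mulr_gt0.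
have -> : X `^ (p / (p - q)) = W `^ g.
  by rewrite -powRrM /g; congr (_ `^ _); field; rewrite !gt_eqF.
have zb0 : 0 < z `^ b by exact: powR_gt0.
have yb0 : 0 < y `^ b by exact: powR_gt0.
have DW0 : 0 < D * W by rewrite mulr_gt0.
set Q := n + _; have Q0 : 0 < Q by rewrite ltr_wpDl// divr_gt0.
(* Since b D = q/(q-1), the coefficient b (q-1)/q equals 1/D, which makes D W a common
   denominator. *)
have -> : (z `^ b)^-1 + b * (n * ((q - 1) / q / W)) = Q / (D * W).
  by rewrite /Q /b /D; field; rewrite !gt_eqF.
move=> H; rewrite -powRM ?(ltW D0) ?(ltW W0)//.
rewrite -powRVl ?(ltW Q0)// -powRM ?(ltW DW0) ?invr_ge0 ?(ltW Q0)//.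
rewrite -[leLHS]powRr1 ?(ltW y0)// -bg powRrM.
rewrite ge0_ler_powR ?nnegrE ?(ltW g0) ?powR_ge0//.
  by rewrite divr_ge0 ?(ltW Q0) ?(ltW DW0).
rewrite -[leLHS]invrK -[leRHS]invrK invf_div lef_pV2 ?posrE ?invr_gt0//.
by rewrite divr_gt0.
Qed.

(** * Convexity and finiteness of extended-real sums *)

Lemma convex_functionP (R : realType) (V : normedModType R) (F : V -> R^o) :
  convex_function [set: V] F -> forall (x y : V) (t : R), 0 <= t <= 1 ->
  F (t *: x + (1 - t) *: y) <= t * F x + (1 - t) * F y.
Proof.
move=> cF x y t /andP[t0 t1].
exact: (cF (Itv01 t0 t1) x y (in_setT _) (in_setT _)).
Qed.

(** The differential is the limit of difference quotients from the right; for t in ]0, 1] convexity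
    bounds each of them by F(v+h) - F(v). *)
Lemma convex_tangent (R : realType) (V : normedModType R) (F : V -> R^o)
    (v h : V) :
  convex_function [set: V] F -> differentiable F v ->
  F v + 'd F v h <= F (v + h).
Proof.
move=> cF dF; rewrite -lerBrDl -deriveE//.
have /cvg_ex[/= l Fl] : derivable F v h by exact: diff_derivable.
have -> : 'D_h F v = l by apply/cvg_lim.
have rF : t^-1 *: ((F \o shift v) (t *: h) - F v) @[t --> (0:R)^'+] --> l.
  exact: cvg_dnbhs_at_right Fl.
apply: (cvgr_to_le rF); near=> t.
have t0 : 0 < t by near: t; exact: nbhs_right_gt.
have t1 : t <= 1 by near: t; apply: nbhs_right_le.
have := convex_functionP cF (v + h) v; move=> /(_ t); rewrite (ltW t0) t1.
move=> /(_ isT).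
have -> : t *: (v + h) + (1 - t) *: v = t *: h + v.
  by rewrite scalerDr addrAC -scalerDl addrC subrKC scale1r.
move=> H; rewrite /= -[_ *: _]/(_ * _) mulrC ler_pdivrMr//; lra.
Unshelve. all: by end_near. Qed.

(** With no term equal to -oo, a single +oo would make the whole sum +oo. This lets the bounds of
    the stable decomposition be handled as real inequalities. *)
Lemma sum_lt_pinfty (R : realType) (N : nat) (f : 'I_N -> \bar R) (r : R) :
  (forall k, -oo < f k)%E -> (\sum_k f k <= r%:E)%E ->
  exists g : 'I_N -> R, forall k, f k = (g k)%:E.
Proof.
move=> fN fr; exists (fun k => fine (f k)) => k;
  rewrite fineK// fin_numElt fN/=.
rewrite ltNge leye_eq; apply/negP => /eqP fk.
have : (\sum_k f k = +oo)%E.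
  apply/esum_eqyP; last by exists k; rewrite mem_index_enum.
  by move=> i _; rewrite -ltNye.
by move=> foo; move: fr; rewrite foo leye_eq.
Qed.

(** * One step of the method *)

Section AdditiveSchwarz.
Context (R : realType) (V : completeNormedModType R) (N : nat)
  (Vk : 'I_N -> completeNormedModType R)
  (F : V -> R^o) (G : V -> \bar R)
  (Rs : forall k : 'I_N, {linear Vk k -> V})
  (d Gk : forall k : 'I_N, Vk k -> V -> \bar R).
Hypothesis convF : convex_function [set: V] F.
Hypothesis diffF : forall v, differentiable F v.
Hypothesis pclG : pcl_functional G.
Hypothesis pcld : forall k v, pcl_functional (fun wk : Vk k => d wk v).
Hypothesis pclGk : forall k v, pcl_functional (fun wk : Vk k => Gk wk v).

Lemma edom_fin v : edom G v -> G v = (fine (G v))%:E.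
Proof.
by case: pclG => -[Gny _] _ _ Gv; rewrite fineK// fin_numElt Gny.
Qed.

Lemma energy_edom v : edom G v -> energy F G v = (fine (energy F G v))%:E.
Proof. by move=> /edom_fin Gv; rewrite /energy Gv. Qed.

(* Convexity makes [bregman], hence [d], nonnegative; this is what allows
   [omega0] to be replaced by the larger [omega]. *)
Lemma local_functional_bound (omega0 omega : R) (u : V) (k : 'I_N)
    (w : forall k, Vk k) (r : R) :
  local_stability F G Rs d Gk omega0 -> omega0 <= omega -> edom G u ->
  (local_functional F Rs d Gk omega u (w k) <= r%:E)%E ->
  (energy F G (u + Rs k (w k))%R <= r%:E)%E.
Proof.
move=> [om0 LS] omle Gu.
have {LS} [LF LG] := LS u w k Gu.
have om : 0 < omega by rewrite (lt_le_trans om0).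
have [[dny _] _ _] := @pcld k u; have [[Gkny _] _ _] := @pclGk k u.
have {dny}:= dny (w k); have {Gkny} := Gkny (w k);
  rewrite /local_functional /energy.
(* An infinite value of [Gk] or [d] makes the local functional +oo, as [omega] is positive; this
   contradicts the bound by [r]. *)
move: LF LG; case: (Gk (w k) u) => [gk| |]//; case: (d (w k) u) => [dk| |]//;
  last 2 first.
- by move=> _ _ _ _; rewrite mulry gtr0_sg// mul1e addey.
- by move=> _ _ _ _; rewrite mulry gtr0_sg// mul1e addeC.
rewrite /bregman lee_fin => LF LG _ _; rewrite -!EFinM -!EFinD !lee_fin => lr.
apply: (le_trans (leeD2l _ LG)); rewrite lee_fin.
have := convex_tangent (Rs k (w k)) convF (diffF u).
rewrite (_ : u + Rs k (w k) - u = Rs k (w k)) in LF; last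
  by rewrite addrC addKr.
move=> tan.
have dk0 : 0 <= dk by rewrite -(pmulr_rge0 _ om0); lra.
have : omega0 * dk <= omega * dk by rewrite ler_wpM2r.
lra.
Qed.

(* The right-hand side of the criterion is affine in [tau] with all energies
   involved bounded above by reals, so the sign of [1 - tau * N] is irrelevant. *)
Lemma asm_step_bound (omega0 omega tau c : R) (u x : V) (w w' : forall k, Vk k)
  :
  local_stability F G Rs d Gk omega0 -> omega0 <= omega -> 0 < tau ->
  (forall k, is_argmin (local_functional F Rs d Gk omega u (k := k)) (w k)) ->
  backtracking_criterion F G Rs u w tau ->
  edom G u -> edom G x ->
  x - u = \sum_(k < N) Rs k (w' k) ->
  (\sum_(k < N) d (w' k) u <= c%:E)%E ->
  (\sum_(k < N) Gk (w' k) u <= G x + (N%:R - 1)%:E * G u)%E ->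
  (energy F G (u + tau *: \sum_(k < N) Rs k (w k))%R <=
   ((1 - tau) * fine (energy F G u)
     + tau * (fine (energy F G x) + omega * c))%R%:E)%E.
Proof.
move=> LS omle tau0 wmin crit Gu Gx xu dw' Gkw'; apply: (le_trans crit).
have om : 0 < omega by case: LS => om0 _; exact: lt_le_trans omle.
have [Gue Gxe] := (edom_fin Gu, edom_fin Gx).
have dny k : (-oo < d (w' k) u)%E by case: (@pcld k u) => -[].
have Gny k : (-oo < Gk (w' k) u)%E by case: (@pclGk k u) => -[].
have [dr drE] := sum_lt_pinfty dny dw'.
rewrite Gue Gxe -EFinM -EFinD in Gkw'.
have [gr grE] := sum_lt_pinfty Gny Gkw'.
rewrite (eq_bigr _ (fun k _ => drE k)) sumEFin lee_fin in dw'.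
rewrite (eq_bigr _ (fun k _ => grE k)) sumEFin lee_fin in Gkw'.
(* Minimality of [w k] is tested against the competitor [w' k] from the stable decomposition of x -
   u. *)
have bnd k : (energy F G (u + Rs k (w k))%R <=
    (F u + 'd F u (Rs k (w' k)) + omega * dr k + gr k)%R%:E)%E.
  apply: (local_functional_bound LS omle Gu); apply: (le_trans (wmin k (w' k))).
  by rewrite /local_functional drE grE.
have tau0' : (0 <= tau%:E)%E by rewrite lee_fin ltW.
apply: (le_trans (leeD2l _ (lee_wpmul2l tau0' (lee_sum _ (fun k _ => bnd k))))).
rewrite sumEFin (energy_edom Gu) -!EFinM -EFinD lee_fin.
rewrite !big_split/= sumr_const card_ord -mulr_sumr -(linear_sum ('d F u)) -xu.
have := convex_tangent (x - u) convF (diffF u); rewrite subrKC.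
rewrite /energy Gue Gxe /= -mulr_natr => tan.
have : omega * \sum_k dr k <= omega * c by rewrite ler_wpM2l// ltW.
set D := omega * \sum_k _ => oD.
set S := \sum_i gr i in Gkw' *.
(* The sum over k leaves N - 1 surplus copies of F(u), and the decomposition bound N - 1 copies of
   G(u). Together they turn the weight 1 - tau N of E(u) into 1 - tau. *)
have : tau * ('d F u (x - u) + D + S) <= tau * (F x - F u + omega * c + 
  (fine (G x) + (N%:R - 1) * fine (G u))).
  by rewrite ler_wpM2l ?(ltW tau0)//; lra.
lra.
Qed.

End AdditiveSchwarz.

(** * Sublevel sets and their extrapolations *)

Section SublevelSets.
Context (R : realType) (V : completeNormedModType R) (F : V -> R^o)
  (G : V -> \bar R).
Hypothesis convF : convex_function [set: V] F.
Hypothesis pclG : pcl_functional G.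

Lemma energy_le_edom (u v : V) :
  edom G u -> (energy F G v <= energy F G u)%E -> edom G v.
Proof.
move=> /(edom_fin pclG) Gu; rewrite /energy Gu /edom/=.
by case: (G v) => // r _; rewrite ltry.
Qed.

Lemma energy_segment (u v : V) (t : R) :
  edom G u -> edom G v -> 0 <= t <= 1 ->
  edom G (t *: v + (1 - t) *: u) /\
  fine (energy F G (t *: v + (1 - t) *: u)) <=
    t * fine (energy F G v) + (1 - t) * fine (energy F G u).
Proof.
move=> Gu Gv t01; have [_ cG _] := pclG.
have := cG v u t t01; rewrite (edom_fin pclG Gu) (edom_fin pclG Gv).
rewrite -!EFinM -EFinD => Gx.
have Gxe : edom G (t *: v + (1 - t) *: u) by apply: (le_lt_trans Gx);
  rewrite ltry.
split=> //; move: Gx; rewrite /energy (edom_fin pclG Gxe).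
rewrite (edom_fin pclG Gu) (edom_fin pclG Gv) lee_fin /= => Gx.
have := convex_functionP convF v u t01; lra.
Qed.

(** Boundedness is coercivity at the level E(u0). Convexity is checked on real values, because the
    sublevel set lies in dom G. *)
Lemma sublevel_bounded_convex (u0 : V) :
  coercive (energy F G) -> edom G u0 ->
  bounded_convex (initial_sublevel F G u0).
Proof.
move=> coerE Gu0; split.
  have [r rE] := coerE (fine (energy F G u0)).
  exists r; split; first exact: num_real.
  move=> M rM v Kv; rewrite /= leNgt; apply/negP => Mv.
  have := rE v (lt_trans rM Mv); rewrite -(energy_edom _ pclG Gu0).
  by rewrite ltNge Kv.
move=> x y t /set_mem Kx /set_mem Ky; apply/mem_set.
have Gx := energy_le_edom Gu0 Kx; have Gy := energy_le_edom Gu0 Ky.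
have t01 : 0 <= t%:num <= 1 by rewrite ge0 le1.
have [Gz Ez] := energy_segment Gy Gx t01.
rewrite /initial_sublevel/= in Kx Ky *.
rewrite (energy_edom _ pclG Gu0) (energy_edom _ pclG Gx) lee_fin in Kx.
rewrite (energy_edom _ pclG Gu0) (energy_edom _ pclG Gy) lee_fin in Ky.
rewrite (energy_edom _ pclG Gu0) [leLHS](energy_edom _ pclG Gz) lee_fin.
apply: (le_trans Ez); move: t01 Kx Ky => /andP[t0 t1].
set a := fine _; set b := fine _; set c := fine _ => ac bc.
have : t%:num * a <= t%:num * b by rewrite ler_wpM2l.
have : (1 - t%:num) * c <= (1 - t%:num) * b by rewrite ler_wpM2l// subr_ge0.
lra.
Qed.

End SublevelSets.

(** The set is the image of K x K under a bounded linear map, which preserves both properties. *)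
Lemma extrapolated_bounded_convex (R : realType) (V : completeNormedModType R)
    (K : set V) (tau : R) :
  bounded_convex K -> bounded_convex (extrapolated_set K tau).
Proof.
move=> [[r [_ rK]] cK]; split.
  (* Boundedness only provides bounds strictly larger than [r]. *)
  pose s := `|r| + 1.
  have sK x : K x -> `|x| <= s.
    by apply: rK; rewrite (le_lt_trans (ler_norm _))// ltrDl.
  exists (`|tau^-1| * s + `|tau^-1 - 1| * s); split; first exact: num_real.
  move=> M sM _ [[x y] /= [Kx Ky] <-]; apply: le_trans (ltW sM).
  by apply: (le_trans (ler_normB _ _)); rewrite !normrZ lerD// ler_wpM2l// sK.
move=> _ _ t /set_mem[[a b]/= [Ka Kb] <-] /set_mem[[a' b']/= [Ka' Kb'] <-].
apply/mem_set; exists (t%:num *: a + (1 - t%:num) *: a',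
    t%:num *: b + (1 - t%:num) *: b').
  split; apply/set_mem.
    exact: (cK a a' t (mem_set Ka) (mem_set Ka')).
  exact: (cK b b' t (mem_set Kb) (mem_set Kb')).
rewrite /conv/= !scalerDr !scalerN !scalerA opprD addrACA.
by congr (_ *: _ - _ *: _ + (_ *: _ - _ *: _)); rewrite mulrC.
Qed.

(** The two coefficients add up to 1, so the pair (x, x) is sent to x. Thus the stable decomposition
    on the extrapolated set applies to points of K. *)
Lemma sub_extrapolated_set (R : realType) (V : normedModType R)
    (K : set V) (tau : R) : K `<=` extrapolated_set K tau.
Proof.
by move=> x Kx; exists (x, x) => //=; rewrite -scalerBl subKr scale1r.
Qed.

(** * Descent of the energy gap along the iterates *)

Section Iteration.
Context (R : realType) (V : completeNormedModType R) (N : nat)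
  (Vk : 'I_N -> completeNormedModType R)
  (F : V -> R^o) (G : V -> \bar R) (ustar : V)
  (Rs : forall k : 'I_N, {linear Vk k -> V})
  (d Gk : forall k : 'I_N, Vk k -> V -> \bar R)
  (q p tau0 omega0 omega rho : R) (C0 mu : set V -> R)
  (u : nat -> V) (w : nat -> forall k : 'I_N, Vk k) (tau : nat -> R).
Hypothesis convF : convex_function [set: V] F.
Hypothesis diffF : forall v, differentiable F v.
Hypothesis pclG : pcl_functional G.
Hypothesis coerE : coercive (energy F G).
Hypothesis minE : is_argmin (energy F G) ustar.
Hypothesis pcld : forall k v, pcl_functional (fun wk : Vk k => d wk v).
Hypothesis pclGk : forall k v, pcl_functional (fun wk : Vk k => Gk wk v).
Hypothesis stable : stable_decomposition G Rs d Gk q C0.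
Hypothesis tau0_gt0 : 0 < tau0.
Hypothesis LS : local_stability F G Rs d Gk omega0.
Hypothesis sharp : sharpness F G ustar p mu.
Hypothesis omega_ge : omega0 <= omega.
Hypothesis rho01 : 0 < rho < 1.
Hypothesis asm : asm_backtracking F G Rs d Gk tau0 omega rho u w tau.

Let K0 := initial_sublevel F G (u 0%N).
Let zeta n := fine (energy F G (u n)) - fine (energy F G ustar).

Lemma step_gt0 n : 0 < tau n.
Proof.
have [_ t0 tS] := asm; elim: n => [|n IH]; first by rewrite t0.
have [_ [m [-> _ _]] _] := tS n; have /andP[r0 _] := rho01.
by rewrite mulr_gt0 ?exprn_gt0// divr_gt0.
Qed.

Lemma K0_bounded_convex : bounded_convex K0.
Proof. by have [Gu0 _ _] := asm; exact: sublevel_bounded_convex. Qed.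

Lemma Ktau_bounded_convex t : bounded_convex (extrapolated_set K0 t).
Proof. exact/extrapolated_bounded_convex/K0_bounded_convex. Qed.

Lemma K0_edom v : K0 v -> edom G v.
Proof. by have [Gu0 _ _] := asm; exact: energy_le_edom. Qed.

Lemma K0_ustar : K0 ustar. Proof. exact: minE. Qed.

(** [asm_step_bound] at x = t [ustar] + (1 - t) u_n. Finiteness of the new energy is part of the
    conclusion: membership of u_(n+1) in [K0] is deduced only afterwards, and [fine] would send +oo
    to 0. *)
Lemma asm_descent_distance n (t : R) : K0 (u n) -> 0 <= t <= 1 ->
  energy F G (u n.+1) \is a fin_num /\
  zeta n.+1 <= zeta n - tau n.+1 * (t * zeta n -
    omega * C0 (extrapolated_set K0 (tau n.+1)) `^ q / q
      * (t `^ q * `|u n - ustar| `^ q)).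
Proof.
move=> Kn t01; have [q1 _ _ SD] := stable; have [_ _ tS] := asm.
have [wmin [m [_ crit _]] uS] := tS n.
have Gn := K0_edom Kn; have Gs := K0_edom K0_ustar.
have [Gx Ex] := energy_segment convF pclG Gn Gs t01.
set x := t *: ustar + (1 - t) *: u n in Gx Ex.
have Kx : K0 x.
  have [_ /(_ ustar (u n))] := K0_bounded_convex.
  have /andP[t0 t1] := t01.
  move=> /(_ (Itv01 t0 t1) (mem_set K0_ustar) (mem_set Kn)).
  by move=> /set_mem.
have [w' [xu dw' Gkw']] := SD _ (Ktau_bounded_convex (tau n.+1)) x (u n)
  (conj (sub_extrapolated_set _ Kx) Gx) (conj (sub_extrapolated_set _ Kn) Gn).
have := asm_step_bound convF diffF pclG pcld pclGk LS omega_ge (step_gt0 n.+1)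
  wmin crit Gn Gx xu dw' Gkw'.
rewrite -uS => Eu.
have xuE : `|x - u n| `^ q = t `^ q * `|u n - ustar| `^ q.
  have -> : x - u n = t *: (ustar - u n).
    by rewrite /x scalerBl scale1r scalerBr -addrA [u n - _ - _]addrAC subrr
      sub0r.
  by case/andP: t01 => t0 _; rewrite normrZ ger0_norm// powRM// distrC.
have Efin : energy F G (u n.+1) \is a fin_num.
  rewrite fin_numElt (le_lt_trans Eu) ?ltry// andbT.
  by apply: lt_le_trans (minE _); rewrite (energy_edom _ pclG Gs) ltNyr.
split=> //; move: Eu; rewrite -(fineK Efin) lee_fin xuE /zeta.
set a := fine (energy F G (u n.+1)); set b := fine (energy F G (u n)) in Ex *.
set e := fine (energy F G ustar) in Ex *; set f := fine (energy F G x) in Ex *.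
set T := t `^ q * _; set C := _ `^ q => ab.
have : tau n.+1 * f <= tau n.+1 * (t * e + (1 - t) * b).
  by rewrite ler_wpM2l// ltW// step_gt0.
have -> : omega * C / q * T = omega * (C / q * T) by rewrite !mulrA.
lra.
Qed.

(** The choice t = 0 reduces the descent estimate to monotonicity of the energy; q > 1 ensures that
    the power of 0 vanishes. *)
Lemma iterate_K0 n : K0 (u n).
Proof.
elim: n => [|n IH]; first exact: lexx.
have [q1 _ _ _] := stable.
have t01 : 0 <= (0 : R) <= 1 by rewrite lexx ler01.
have [Ef] := asm_descent_distance IH t01.
rewrite powR0 ?gt_eqF ?(lt_trans ltr01)// !(mul0r, mulr0, subr0) lerD2r => En.
have Gn := K0_edom IH; apply: le_trans IH;
  rewrite (energy_edom _ pclG Gn) -(fineK Ef).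
by rewrite lee_fin.
Qed.

Lemma energy_iterate_fin n : energy F G (u n) = (fine (energy F G (u n)))%:E.
Proof. exact/energy_edom/K0_edom/iterate_K0. Qed.

Lemma energy_ustar_fin : energy F G ustar = (fine (energy F G ustar))%:E.
Proof. exact/energy_edom/K0_edom/K0_ustar. Qed.

Lemma energy_gapE n : (energy F G (u n) - energy F G ustar)%E = (zeta n)%:E.
Proof. by rewrite energy_iterate_fin energy_ustar_fin. Qed.

Lemma gap_ge0 n : 0 <= zeta n.
Proof.
by rewrite subr_ge0 -lee_fin -energy_iterate_fin -energy_ustar_fin.
Qed.

Lemma gap_eq0 n : (energy F G (u n) == energy F G ustar) = (zeta n == 0).
Proof. by rewrite energy_iterate_fin energy_ustar_fin eqe subr_eq0. Qed.

Lemma gap_decr n : zeta n.+1 <= zeta n.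
Proof.
have [q1 _ _ _] := stable.
have t01 : 0 <= (0 : R) <= 1 by rewrite lexx ler01.
have [_] := asm_descent_distance (iterate_K0 n) t01.
by rewrite powR0 ?gt_eqF ?(lt_trans ltr01)// !(mul0r, mulr0, subr0).
Qed.

Lemma gap_gt0_prev n i : 0 < zeta n -> (i <= n)%N -> 0 < zeta i.
Proof.
move=> zn; elim: n zn => [|n IH] zn; first by rewrite leqn0 => /eqP ->.
rewrite leq_eqVlt => /predU1P[->//|]; rewrite ltnS; apply: IH.
exact: lt_le_trans (gap_decr n).
Qed.

Lemma omega_gt0 : 0 < omega.
Proof. by case: LS => om _; exact: lt_le_trans omega_ge. Qed.

Lemma mu_K0_gt0 : 0 < mu K0.
Proof.
by have [_ /(_ K0 K0_bounded_convex K0_ustar)[]] := sharp.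
Qed.

Lemma distance_gap n :
  `|u n - ustar| `^ q <= (p / mu K0 * zeta n) `^ (q / p).
Proof.
have [p1 /(_ K0 K0_bounded_convex K0_ustar)[m0 /(_ _ (iterate_K0 n))]] := sharp.
have [q1 _ _ _] := stable.
rewrite energy_gapE lee_fin => H; have p0 : 0 < p by rewrite (lt_trans ltr01).
have -> : `|u n - ustar| `^ q = (`|u n - ustar| `^ p) `^ (q / p).
  by rewrite -powRrM; congr (_ `^ _); field; rewrite gt_eqF.
rewrite ge0_ler_powR ?nnegrE ?powR_ge0//.
- by rewrite divr_ge0 ?(ltW p0)// (le_trans ler01)// ltW.
- by rewrite mulr_ge0 ?gap_ge0// divr_ge0 ?ltW.
rewrite -ler_pdivrMl ?divr_gt0// invf_div.
by apply: le_trans H.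
Qed.

Lemma asm_descent n (t : R) : 0 <= t <= 1 ->
  zeta n.+1 <= zeta n - tau n.+1 * (t * zeta n -
    omega * C0 (extrapolated_set K0 (tau n.+1)) `^ q / q
      * (t `^ q * (p / mu K0 * zeta n) `^ (q / p))).
Proof.
move=> t01; have [_ H] := asm_descent_distance (iterate_K0 n) t01.
have [q1 _ _ _] := stable.
apply: (le_trans H); rewrite lerD2l lerN2 ler_pM2l ?step_gt0// lerD2l lerN2.
apply: ler_wpM2l; last by apply: ler_wpM2l; rewrite ?powR_ge0// distance_gap.
rewrite divr_ge0 ?mulr_ge0 ?powR_ge0 ?(ltW omega_gt0)//.
by rewrite (le_trans ler01)// ltW.
Qed.

(** * The constants kappa and their power mean *)

Let CK n := C0 (extrapolated_set K0 (tau n)).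
Let nu := - (q - 1)^-1.
Let kap n := kappa q omega C0 K0 (tau n).
Let kbar := kappa_bar q omega C0 K0 tau nu.

Lemma q_gt1 : 1 < q. Proof. by case: stable. Qed.

Lemma omega_CK_gt0 n : 0 < omega * CK n `^ q.
Proof.
have [_ C0gt0 _ _] := stable.
by rewrite mulr_gt0 ?omega_gt0// powR_gt0// C0gt0//; exact: Ktau_bounded_convex.
Qed.

(** Both smallness conditions involve [C0 K0]. This carries them over to the constant of each step,
    where they keep the optimal t in [0, 1]. *)
Lemma omega_CK_ge n : omega * C0 K0 `^ q <= omega * CK n `^ q.
Proof.
have [_ C0gt0 C0mono _] := stable; have q0 : 0 <= q.
  exact/ltW/(lt_trans ltr01)/q_gt1.
have KK := @sub_extrapolated_set _ _ K0 (tau n).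
have [bK bKt] := (K0_bounded_convex, Ktau_bounded_convex (tau n)).
rewrite ler_wpM2l ?(ltW omega_gt0)// ge0_ler_powR ?nnegrE//.
- exact/ltW/C0gt0.
- exact/ltW/C0gt0.
- exact: C0mono.
Qed.

Lemma kappa_gt0 n : 0 < kap n.
Proof. by rewrite divr_gt0 ?omega_CK_gt0// powR_gt0// step_gt0. Qed.

Lemma nu_neq0 : nu != 0.
Proof. by rewrite oppr_eq0 invr_eq0 gt_eqF// subr_gt0 q_gt1. Qed.

(** Raising to nu undoes the outer root of the power mean. The sum over 1 <= j <= n is shifted to
    match the recursion, whose step i uses [tau i.+1]. *)
Lemma kappa_bar_powR n :
  kbar n `^ nu = n%:R^-1 * \sum_(i < n) kap i.+1 `^ nu.
Proof.
rewrite /kbar /kappa_bar powR_invK ?nu_neq0// ?big_add1 ?big_mkord//=.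
by rewrite mulr_ge0 ?invr_ge0// sumr_ge0// => i _; rewrite powR_ge0.
Qed.

Lemma kappa_bar_gt0 n : (0 < n)%N -> 0 < kbar n.
Proof.
move=> n0; apply: powR_gt0; rewrite mulr_gt0 ?invr_gt0 ?ltr0n//.
rewrite big_add1 big_mkord /= -[n]prednK//= big_ord_recl ltr_wpDr ?powR_gt0
  ?kappa_gt0//.
by apply: sumr_ge0 => i _; rewrite powR_ge0.
Qed.

(** * Linear convergence for p = q *)

Lemma gap_step_linear n (t : R) : p = q -> 0 <= t <= 1 ->
  zeta n.+1 <= zeta n -
    tau n.+1 * zeta n * (t - t `^ q / (mu K0 / (omega * CK n.+1 `^ q))).
Proof.
move=> pq t01; apply: (le_trans (asm_descent n t01)).
have q0 : 0 < q by rewrite (lt_trans ltr01) ?q_gt1.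
rewrite pq divff ?gt_eqF// powRr1; last first.
  by rewrite mulr_ge0 ?gap_ge0// divr_ge0 ?(ltW q0)// ltW// mu_K0_gt0.
rewrite le_eqVlt; apply/orP; left; apply/eqP; rewrite -/(CK n.+1).
have a0 := omega_CK_gt0 n.+1; have m0 := mu_K0_gt0.
set a := omega * _ in a0 *; field.
by rewrite !gt_eqF.
Qed.

Lemma gap_step_linear_optimal n : p = q ->
  mu K0 <= q * (omega * CK n.+1 `^ q) ->
  zeta n.+1 <= (1 - tau n.+1 * ((q - 1) / q *
    (mu K0 / (q * (omega * CK n.+1 `^ q))) `^ (q - 1)^-1)) * zeta n.
Proof.
move=> pq mle; have a0 := omega_CK_gt0 n.+1; have m0 := mu_K0_gt0.
have q0 : 0 < q by rewrite (lt_trans ltr01) ?q_gt1.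
have := optimal_step (tau := tau n.+1) (y := zeta n.+1) (z := zeta n) q_gt1
   (divr_gt0 m0 a0).
rewrite ler_pdivrMr// => /(_ mle (fun t => @gap_step_linear n t pq)).
move: a0; set a := omega * _ => a0.
have -> : mu K0 / (q * a) = mu K0 / a / q by field; rewrite !gt_eqF.
lra.
Qed.

(** Two regimes: if mu <= q omega C^q the stationary t is admissible and gives the second term of
    the minimum; otherwise t = 1 gives the first. *)
Lemma gap_step_linear_min n : p = q ->
  zeta n.+1 <= (1 - tau n.+1 * Num.min (1 - omega * CK n.+1 `^ q / mu K0)
    ((q - 1) / q *
      (mu K0 / (q * (omega * CK n.+1 `^ q))) `^ (q - 1)^-1)) * zeta n.
Proof.
move=> pq; have tz : 0 <= tau n.+1 * zeta n.
  by rewrite mulr_ge0 ?gap_ge0// ltW// step_gt0.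
have [mle|/ltW mge] := leP (mu K0) (q * (omega * CK n.+1 `^ q)).
  apply: (le_trans (gap_step_linear_optimal pq mle)).
  set B := _ * _ `^ (q - 1)^-1; set A := 1 - _ / _.
  have : tau n.+1 * zeta n * Num.min A B <= tau n.+1 * zeta n * B.
    by rewrite ler_wpM2l// ge_min lexx orbT.
  lra.
have t01 : 0 <= (1 : R) <= 1 by rewrite lexx ler01.
apply: (le_trans (gap_step_linear n pq t01)).
rewrite powR1 mul1r invf_div.
set B := _ * _ `^ (q - 1)^-1; set A := 1 - _ / _.
have : tau n.+1 * zeta n * Num.min A B <= tau n.+1 * zeta n * A.
  by rewrite ler_wpM2l// ge_min lexx.
lra.
Qed.

Lemma gap_linear_rate n : p = q -> mu K0 <= q * (omega * C0 K0 `^ q) ->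
  (0 < n)%N -> 0 < zeta n.-1 ->
  zeta n <= (1 - (q - 1) / q * (mu K0 / (q * kbar n)) `^ (- nu)) ^+ n * zeta
    0%N.
Proof.
move=> pq mle n0 zn.
have q0 : 0 < q by rewrite (lt_trans ltr01) ?q_gt1.
have m0 := mu_K0_gt0.
have mq : 0 <= mu K0 / q by rewrite divr_ge0 ?ltW.
pose c := (q - 1) / q * (mu K0 / q) `^ (- nu).
have powE x : 0 < x -> (mu K0 / (q * x)) `^ (- nu) = (mu K0 / q) `^ (- nu) * x
  `^ nu.
  move=> x0; rewrite invfM mulrA powRM ?invr_ge0 ?(ltW x0)//.
  by rewrite powRVl ?(ltW x0)// (powRN x) invrK.
have zpos i : (i < n)%N -> 0 < zeta i.
  by move=> ni; apply: (gap_gt0_prev zn); rewrite -ltnS prednK.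
have zS i : (i < n)%N -> zeta i.+1 <= (1 - c * kap i.+1 `^ nu) * zeta i.
  move=> ni; have a0 := omega_CK_gt0 i.+1.
  have := @gap_step_linear_optimal i pq (le_trans mle _).
  rewrite ler_pM2l// => /(_ (omega_CK_ge _)) H; apply: (le_trans H).
  have := powE _ a0; rewrite /nu opprK (powRN (omega * _)) => ->.
  rewrite /kap /kappa -/(CK _) powR_kappa ?q_gt1 ?step_gt0// /c /nu opprK.
  set A := (_ / q) `^ _; set W := _ `^ (q - 1)^-1.
  by rewrite le_eqVlt; apply/orP; left; apply/eqP; ring.
have [x1 zle] := linear_decay zpos (gap_ge0 n) zS.
apply: (le_trans zle); apply: ler_wpM2r; first exact: gap_ge0.
have := prod_onem_le_mean n0 (fun i : 'I_n => x1 i (ltn_ord i)).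
move=> H; apply: (le_trans H).
by rewrite -mulr_sumr powE ?kappa_bar_gt0// kappa_bar_powR mulrA mulrCA -/c.
Qed.

(** * Sublinear convergence for p > q *)

Lemma gap_step_sublinear n : q < p -> 0 < zeta n ->
  zeta n `^ ((p - q) / p) <=
    p `^ (q / p) * (omega * C0 K0 `^ q) / mu K0 `^ (q / p) ->
  zeta n.+1 <= zeta n - (q - 1) / q *
    (p `^ (q / p) * kap n.+1 / mu K0 `^ (q / p)) `^ nu *
    zeta n `^ (1 + (p - q) / (p * (q - 1))).
Proof.
move=> qp z0 zle; have a0 := omega_CK_gt0 n.+1; have m0 := mu_K0_gt0.
have q0 : 0 < q by rewrite (lt_trans ltr01) ?q_gt1.
have p0 : 0 < p by rewrite (lt_trans q0).
have q10 : 0 < q - 1 by rewrite subr_gt0 q_gt1.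
have pq0 : 0 < p - q by rewrite subr_gt0.
have tau1 := step_gt0 n.+1.
set B := p `^ (q / p) in zle *; set M := mu K0 `^ (q / p) in zle *.
have B0 : 0 < B by exact: powR_gt0.
have M0 : 0 < M by exact: powR_gt0.
set Z1 := zeta n `^ ((p - q) / p) in zle *.
pose Z2 := zeta n `^ (q / p).
have Z10 : 0 < Z1 by exact: powR_gt0.
have Z20 : 0 < Z2 by exact: powR_gt0.
(* The distance term is proportional to [Z2], so after factoring out [zeta n] it keeps a factor 1 /
   [Z1]; this dictates the value of [c] below. The smallness hypothesis on [Z1] then amounts to
   [c <= q]. *)
have zE : zeta n = Z1 * Z2.
  rewrite -powRD ?(gt_eqF z0) ?implybT// -mulrDl subrK divff ?gt_eqF//.
  by rewrite powRr1 ?(ltW z0).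
have BMa0 : 0 < B * (omega * CK n.+1 `^ q) / M.
  by rewrite divr_gt0// mulr_gt0.
pose c := q * (Z1 / (B * (omega * CK n.+1 `^ q) / M)).
have c0 : 0 < c by rewrite mulr_gt0// divr_gt0.
have cq : c <= q.
  rewrite -[leRHS]mulr1 ler_pM2l// ler_pdivrMr// mul1r.
  apply: (le_trans zle); rewrite ler_pM2r ?invr_gt0// ler_pM2l//.
  exact: omega_CK_ge.
have H (t : R) : 0 <= t <= 1 ->
    zeta n.+1 <= zeta n - tau n.+1 * zeta n * (t - t `^ q / c).
  move=> t01; apply: (le_trans (asm_descent n t01)); rewrite -/(CK n.+1).
  rewrite powRM ?divr_ge0 ?(ltW p0) ?(ltW z0) ?(ltW m0)// -/Z2.
  rewrite powRM ?invr_ge0 ?(ltW p0) ?(ltW m0)// powRVl ?(ltW m0)// -/B -/M.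
  rewrite le_eqVlt; apply/orP; left; apply/eqP; rewrite zE /c.
  move: a0; set a := omega * _ => a0; field.
  by rewrite !gt_eqF.
apply: (le_trans (optimal_step q_gt1 c0 cq H)).
have cE : (c / q) `^ (q - 1)^-1 = zeta n `^ ((p - q) / (p * (q - 1))) /
     (B * (omega * CK n.+1 `^ q) / M) `^ (q - 1)^-1.
  have -> : c / q = Z1 / (B * (omega * CK n.+1 `^ q) / M).
    by rewrite /c mulrAC divff ?mul1r// gt_eqF.
  rewrite powRM ?(ltW Z10) ?invr_ge0 ?(ltW BMa0)// powRVl ?(ltW BMa0)//.
  congr (_ / _); rewrite -powRrM; congr (_ `^ _).
  by rewrite invfM mulrA.
have kE : B * kap n.+1 / M = B * (omega * CK n.+1 `^ q) / M / tau n.+1 `^ (q -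
  1).
  by rewrite /kap /kappa -/(CK _) !mulrA [LHS]mulrAC.
rewrite kE powR_kappa ?q_gt1// cE powRD ?(gt_eqF z0) ?implybT//.
rewrite powRr1 ?(ltW z0)//.
set W := _ `^ (q - 1)^-1; set Y := zeta n `^ _.
by rewrite le_eqVlt; apply/orP; left; apply/eqP; ring.
Qed.

Lemma gap_sublinear_rate n : q < p ->
  zeta 0%N <= (p `^ (q / p) * omega * C0 K0 `^ q / mu K0 `^ (q / p))
                `^ (p / (p - q)) ->
  (0 < n)%N ->
  zeta n <= (p * q / (p - q)) `^ (p * (q - 1) / (p - q))
      * (p `^ (q / p) * kbar n / mu K0 `^ (q / p)) `^ (p / (p - q))
    / (n%:R + p * q / (p - q)
         * (p `^ (q / p) * kbar n / mu K0 `^ (q / p)) `^ (- nu)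
         / zeta 0%N `^ ((p - q) / (p * (q - 1))))
        `^ (p * (q - 1) / (p - q)).
Proof.
move=> qp zle n0.
(* A vanishing gap satisfies the bound trivially. Otherwise all earlier gaps are positive, as their
   negative powers require. *)
have [zn|zn] := ltP 0 (zeta n); last first.
  by apply: (le_trans zn); rewrite divr_ge0 ?mulr_ge0 ?powR_ge0.
have m0 := mu_K0_gt0.
have q0 : 0 < q by rewrite (lt_trans ltr01) ?q_gt1.
have p0 : 0 < p by rewrite (lt_trans q0).
have q10 : 0 < q - 1 by rewrite subr_gt0 q_gt1.
have pq0 : 0 < p - q by rewrite subr_gt0.
have zpos i : (i <= n)%N -> 0 < zeta i by exact: gap_gt0_prev.
have zdecr i : zeta i <= zeta 0%N.
  by elim: i => // i IH; exact: le_trans (gap_decr i) IH.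
have B0 : 0 < p `^ (q / p) by exact: powR_gt0.
have M0 : 0 < mu K0 `^ (q / p) by exact: powR_gt0.
have a0 : 0 < C0 K0 `^ q.
  by have [_ C0gt0 _ _] := stable; rewrite powR_gt0// C0gt0//;
    exact: K0_bounded_convex.
have om := omega_gt0.
(* The initial smallness, raised to (p-q)/p, persists because the gaps decrease. *)
have zsmall i : (i <= n)%N -> zeta i `^ ((p - q) / p) <=
    p `^ (q / p) * (omega * C0 K0 `^ q) / mu K0 `^ (q / p).
  move=> ni; rewrite mulrA; set b := (X in _ <= X).
  have b0 : 0 < b by rewrite divr_gt0// !mulr_gt0.
  rewrite -[leRHS](powRr1 (ltW b0)).
  have -> : 1 = p / (p - q) * ((p - q) / p) :> R by field; rewrite !gt_eqF.
  rewrite [leRHS]powRrM ge0_ler_powR ?nnegrE ?powR_ge0//.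
  - by rewrite divr_ge0 ?(ltW p0) ?(ltW pq0).
  - exact/ltW/zpos.
  - exact: le_trans (zdecr i) zle.
pose beta := (p - q) / (p * (q - 1)).
have beta0 : 0 < beta by rewrite divr_gt0// mulr_gt0.
pose c i := (q - 1) / q *
  (p `^ (q / p) * kap i.+1 / mu K0 `^ (q / p)) `^ nu.
have c0 i : 0 <= c i.
  by rewrite mulr_ge0 ?powR_ge0// divr_ge0 ?(ltW q10) ?(ltW q0).
have zS i : (i < n)%N -> zeta i.+1 <= zeta i - c i * zeta i `^ (1 + beta).
  by move=> ni; apply: gap_step_sublinear => //;
    [exact/zpos/ltnW|exact/zsmall/ltnW].
have := sublinear_decay beta0 c0 zpos zS.
have kb0 := kappa_bar_gt0 n0.
have splitE x : 0 < x -> (p `^ (q / p) * x / mu K0 `^ (q / p)) `^ nu =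
    (p `^ (q / p) / mu K0 `^ (q / p)) `^ nu * x `^ nu.
  by move=> x0; rewrite -powRM ?divr_ge0 ?powR_ge0 ?(ltW x0)// mulrAC.
(* Once the common power is factored out, the sum of the kappas to the nu is n times [kbar n] to the
   nu. *)
have -> : \sum_(i < n) c i = n%:R * ((q - 1) / q *
    (p `^ (q / p) * kbar n / mu K0 `^ (q / p)) `^ nu).
  rewrite -mulr_sumr (eq_bigr _ (fun i _ => splitE _ (kappa_gt0 _))).
  rewrite -mulr_sumr splitE// kappa_bar_powR.
  set s := \sum_(_ < _) _; set x := _ `^ nu; field.
  by rewrite (gt_eqF q0) pnatr_eq0 -lt0n n0.
apply: sublinear_rate => //; first exact: q_gt1.
  by rewrite divr_gt0// mulr_gt0.
exact: zpos.
Qed.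

End Iteration.

(** * Both convergence results in terms of extended-real energies *)

Local Open Scope ereal_scope.

Theorem theorem3p10 (R : realType) (V : completeNormedModType R)
    (F : V -> R^o) (G : V -> \bar R) (ustar : V)
    (N : nat) (Vk : 'I_N -> completeNormedModType R)
    (Rs : forall k : 'I_N, {linear Vk k -> V})
    (d Gk : forall k : 'I_N, Vk k -> V -> \bar R)
    (q : R) (C0 : set V -> R) (tau0 omega0 p : R) (mu : set V -> R)
    (omega rho : R)
    (u : nat -> V) (w : nat -> forall k : 'I_N, Vk k) (tau : nat -> R) :
  let E := energy F G in
  let K0 := initial_sublevel F G (u 0%N) in
  let CK t := C0 (extrapolated_set K0 t) in
  let nu := (- (q - 1)^-1)%R in
  let kbar := kappa_bar q omega C0 K0 tau nu in
  let m := mu K0 in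
  let zeta0 := fine (E (u 0%N) - E ustar) in
  reflexive_space V ->
  convex_function [set: V] F -> (forall v, differentiable F v) ->
  pcl_functional G ->
  coercive E ->
  is_argmin E ustar ->
  (0 < N)%N ->
  (forall k, [/\ reflexive_space (Vk k), bounded_operator (Rs k) &
                 adjoint_surjective (Rs k)]) ->
  space_decomposition Rs ->
  (forall k v, pcl_functional (fun wk => d k wk v)) ->
  (forall k v, pcl_functional (fun wk => Gk k wk v)) ->
  stable_decomposition G Rs d Gk q C0 ->
  strengthened_convexity F G Rs tau0 ->
  local_stability F G Rs d Gk omega0 ->
  sharpness F G ustar p mu ->
  (omega0 <= omega)%R -> (0 < rho < 1)%R ->
  asm_backtracking F G Rs d Gk tau0 omega rho u w tau ->
  (p = q ->
    (forall n : nat, E (u n) != E ustar ->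
       (E (u n.+1) - E ustar) / (E (u n) - E ustar) <=
       (1 - tau n.+1 *
          Num.min (1 - omega * CK (tau n.+1) `^ q / m)
                  ((q - 1) / q *
                   (m / (q * omega * CK (tau n.+1) `^ q)) `^ (q - 1)^-1))%:E)
    /\
    ((m <= q * omega * C0 K0 `^ q)%R ->
     forall n : nat, (1 <= n)%N -> E (u n.-1) != E ustar ->
       E (u n) - E ustar <=
       ((1 - (q - 1) / q * (m / (q * kbar n)) `^ (- nu)) ^+ n)%:E
         * (E (u 0%N) - E ustar)))
  /\
  ((q < p)%R ->
   E (u 0%N) - E ustar <=
     ((p `^ (q / p) * omega * C0 K0 `^ q / m `^ (q / p)) `^ (p / (p - q)))%:E ->
   forall n : nat, (1 <= n)%N ->
     E (u n) - E ustar <=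
     ((p * q / (p - q)) `^ (p * (q - 1) / (p - q))
        * (p `^ (q / p) * kbar n / m `^ (q / p)) `^ (p / (p - q))
      / (n%:R + p * q / (p - q)
           * (p `^ (q / p) * kbar n / m `^ (q / p)) `^ (- nu)
           / zeta0 `^ ((p - q) / (p * (q - 1))))
          `^ (p * (q - 1) / (p - q)))%:E).
Proof.
move=> E K0 CK nu kbar m zeta0 _ convF diffF pclG coerE minE _ _ _ pcld pclGk
  stable [/andP[tau0_gt0 _] _] LS sharp omle rho01 asm.
pose z n := (fine (E (u n)) - fine (E ustar))%R.
have gapE n : E (u n) - E ustar = (z n)%:E.
  exact: energy_gapE convF diffF pclG coerE minE pcld pclGk stable tau0_gt0 LS
    omle rho01 asm n.
have gap_neq0 n : E (u n) != E ustar -> (0 < z n)%R.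
  move=> En; rewrite lt_def (gap_ge0 convF diffF pclG coerE minE pcld pclGk
    stable tau0_gt0 LS omle rho01 asm n) andbT.
  by rewrite -(gap_eq0 convF diffF pclG coerE minE pcld pclGk
    stable tau0_gt0 LS omle rho01 asm n).
have zeta0E : zeta0 = z 0%N by rewrite /zeta0 gapE.
split=> [pq|qp zle n n0].
  split=> [n /gap_neq0 zn|mle n n0 /gap_neq0 zn].
    (* The quotient of extended reals reduces to a real one because [z n] is nonzero. *)
    rewrite !gapE inver gt_eqF// -EFinM lee_fin ler_pdivrMr//.
    rewrite -(mulrA q).
    exact: (gap_step_linear_min convF diffF pclG coerE minE pcld pclGk
      stable tau0_gt0 LS sharp omle rho01 asm n pq).
  rewrite !gapE -EFinM lee_fin.
  rewrite -(mulrA q) in mle.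
  exact: (gap_linear_rate convF diffF pclG coerE minE pcld pclGk
      stable tau0_gt0 LS sharp omle rho01 asm pq mle n0 zn).
rewrite gapE lee_fin in zle.
rewrite gapE lee_fin zeta0E.
exact: (gap_sublinear_rate convF diffF pclG coerE minE pcld pclGk
      stable tau0_gt0 LS sharp omle rho01 asm qp zle n0).
Qed.
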